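(* Let $\epsilon>0$, let $X\subseteq\mathbb{R}^n_+$ be compact, and let $\phi:\mathbb{R}^n_+\to\mathbb{R}_+$, $\phi(x)=\sum_{i=1}^n\phi_i(x_i)$, be a nondecreasing separable concave function whose components $\phi_i$ are nonnegative. Assume that the problem $Z^*_{\mathrm{conc}}=\min\{\phi(x):x\in X\}$ has an optimal solution $x^*=(x_1^*,\dots,x_n^* )$ and bounds $l_i,u_i$ with $0<l_i\le u_i$ such that $x_i^*\in\{0\}\cup[l_i,u_i]$ for all $i\in\{1,\dots,n\}$. Let $\psi=\sum_{i=1}^n\psi_i$ be the piecewise-linear approximation of $\phi$ by tangents at the points $l_i(1+\epsilon)^p$, $p=0,\dots,P_i$, defined in the context, and let $Z^*_{\mathrm{pwl}}=\min\{\psi(x):x\in X\}$. Then $$Z^*_{\mathrm{conc}}\le Z^*_{\mathrm{pwl}}\le\frac{1+\sqrt{\epsilon+1}}{2}\,Z^*_{\mathrm{conc}}.$$ Moreover, the approximation guarantee $\frac{1+\sqrt{\epsilon+1}}{2}$ is tight: for every $\epsilon>0$ it cannot be replaced by any smaller constant valid for all such instances $(n,X,\phi,(l_i),(u_i))$.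
   Context: $\mathbb{R}_+=[0,+\infty)$. The set $X$ need not be convex or connected. ''Nondecreasing separable concave'' means that each $\phi_i:\mathbb{R}_+\to\mathbb{R}_+$ is concave and nondecreasing on $[0,+\infty)$. Construction of $\psi$: for each $i$ let $P_i=\lceil\log_{1+\epsilon}(u_i/l_i)\rceil$ and, for $p\in\{0,\dots,P_i\}$, let $$s_i^p=\phi_i'\bigl(l_i(1+\epsilon)^p\bigr),\qquad f_i^p=\phi_i\bigl(l_i(1+\epsilon)^p\bigr)-l_i(1+\epsilon)^p s_i^p,$$ where $\phi_i'$ denotes the derivative, or the right derivative at points where the derivative does not exist. For $x_i>0$ put $\psi_i(x_i)=\min\{f_i^p+s_i^px_i: p=0,\dots,P_i\}$, put $\psi_i(0)=\phi_i(0)$, and let $\psi(x)=\sum_{i=1}^n\psi_i(x_i)$. *)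

(* Defs.v *)
From HB Require Import structures.
From mathcomp Require Import all_boot all_order all_algebra.
From mathcomp Require Import all_classical all_reals all_analysis.

Set Implicit Arguments.
Unset Strict Implicit.
Unset Printing Implicit Defensive.

Import Order.TTheory GRing.Theory Num.Theory.
Import numFieldNormedType.Exports.

Local Open Scope classical_set_scope.
Local Open Scope ring_scope.

(* Functions on [0, +oo[ are represented by total functions R -> R; every
   hypothesis below is restricted to [0, +oo[, and values at negative reals are
   never used. *)

Definition rderive1 (R : realType) (f : R -> R) (a : R) : R :=
  lim (h^-1 * (f (h + a) - f a) @[h --> (0 : R)^'+]).

(* Two-sided derivative where it exists, right derivative elsewhere. *)
Definition slope (R : realType) (f : R -> R) (a : R) : R :=
  if `[< derivable f a 1 >] then derive1 f a else rderive1 f a.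

Section PiecewiseLinear.
Variables (R : realType) (eps : R) (f : R -> R) (l u : R).

(* The ceiling is a nonnegative integer as soon as 0 < eps and 0 < l <= u. *)
Definition num_pieces : nat :=
  `|Num.ceil (ln (u / l) / ln (1 + eps))|%N.

Definition grid (p : nat) : R := l * (1 + eps) ^+ p.

Definition tangent_slope (p : nat) : R := slope f (grid p).

Definition tangent_icpt (p : nat) : R :=
  f (grid p) - grid p * tangent_slope p.

Definition tangent (p : nat) (x : R) : R :=
  tangent_icpt p + tangent_slope p * x.

(* The p = 0 tangent is also used as the seed of the finite minimum. *)
Definition pwl (x : R) : R :=
  if x == 0 then f 0
  else \big[Num.min/tangent 0 x]_(p < num_pieces.+1) tangent p x.

End PiecewiseLinear.

Definition separable (R : realType) (n : nat) (f : 'I_n -> R -> R)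
    (x : 'rV[R]_n) : R :=
  \sum_(i < n) f i (x 0 i).

Definition separable_pwl (R : realType) (n : nat) (eps : R)
    (phi : 'I_n -> R -> R) (l u : 'I_n -> R) : 'rV[R]_n -> R :=
  separable (fun i => pwl eps (phi i) (l i) (u i)).

Definition is_min_value (R : realType) (T : Type) (F : T -> R) (X : set T)
    (z : R) : Prop :=
  (F @` X) z /\ lbound (F @` X) z.

Record concave_instance (R : realType) (n : nat) (X : set 'rV[R]_n)
    (phi : 'I_n -> R -> R) (l u : 'I_n -> R) : Prop := ConcaveInstance {
  feasible_ge0 : forall x, X x -> forall i, 0 <= x 0 i;
  feasible_compact : compact X;
  cost_ge0 : forall i (x : R), 0 <= x -> 0 <= phi i x;
  cost_nondecreasing :
    forall i (x y : R), 0 <= x -> x <= y -> phi i x <= phi i y;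
  cost_concave :
    forall i, convex_function (`[0, +oo[%classic : set R)
                              (fun x : R => - phi i x);
  bounds_gt0 : forall i, 0 < l i <= u i;
  bounded_optimum : exists xopt : 'rV[R]_n,
    [/\ X xopt,
        forall x, X x -> separable phi xopt <= separable phi x &
        forall i, xopt 0 i = 0 \/ l i <= xopt 0 i <= u i]
}.

(* Main.v *)
(* Every tangent of a concave function majorizes it, hence phi <= psi and
   Zconc <= Zpwl.  For the upper bound only the coordinates of an optimal
   solution matter: each lies between two consecutive grid points a and
   b = (1 + eps) a, and there the smaller of the two tangents is compared with
   the chord of phi; the worst ratio, (1 + sqrt (1 + eps)) / 2, is reached at
   the geometric mean of a and b. *)
Require Import Defs.
From HB Require Import structures.
From mathcomp Require Import all_boot all_order all_algebra.
From mathcomp Require Import all_classical all_reals all_analysis.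
From mathcomp Require Import ring lra.

Set Implicit Arguments.
Unset Strict Implicit.
Unset Printing Implicit Defensive.

Import Order.TTheory GRing.Theory Num.Theory.
Import numFieldNormedType.Exports.

Local Open Scope classical_set_scope.
Local Open Scope ring_scope.

(** * Right derivatives of concave functions as supergradients *)

Section SlopeOfConcave.
Variable R : realType.
Implicit Types (f : R -> R) (a x y z : R).

(** A two-sided derivative is in particular a right limit of the difference quotient, so by
    uniqueness of limits both branches of [slope] agree with that limit. No later proof has to
    decide differentiability. *)
Lemma slope_right_limit f a s :
  h^-1 * (f (h + a) - f a) @[h --> (0 : R)^'+] --> s -> slope f a = s.
Proof.
move=> fs; rewrite /slope; case: asboolP => [fa|_]; last exact/cvg_lim.
apply/esym/(@cvg_unique _ (@Rhausdorff R) _ _ _ _ fs) => //.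
have {fa} : h^-1 *: (f (h%:A + a) - f a) @[h --> (0 : R)^'] --> derive1 f a.
  by rewrite derive1E; exact: fa.
rewrite -(_ : (fun h : R => h^-1 * (f (h + a) - f a)) =
  (fun h : R => h^-1 *: (f (h%:A + a) - f a))); last first.
  by apply/funext => h /=; rewrite /GRing.scale/= mulr1.
exact: cvg_dnbhs_at_right.
Qed.

Lemma slope_right_affine f a b s : a < b ->
  (forall x, a <= x <= b -> f x = f a + s * (x - a)) -> slope f a = s.
Proof.
move=> ab fE; apply: slope_right_limit; apply: cvg_near_cst.
near=> h; have h0 : 0 < h by [].
rewrite fE; first by rewrite addrK addrC addKr mulrCA mulVf ?mulr1 ?gt_eqF.
rewrite lerDr ltW//= -lerBrDr; near: h.
by apply: nbhs_right_le; rewrite subr_gt0.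
Unshelve. all: by end_near. Qed.

Definition concave_nneg f :=
  convex_function (`[0, +oo[%classic : set R) (fun x : R => - f x).

Lemma concave_nnegP f : concave_nneg f <->
  (forall t x y, 0 <= t -> t <= 1 -> 0 <= x -> 0 <= y ->
     t * f x + (1 - t) * f y <= f (t * x + (1 - t) * y)).
Proof.
split=> [fc t x y t0 t1 x0 y0 | fc t x y /[!inE]/= /[!in_itv]/= /[!andbT] x0 y0].
  have /(_ x y) := fc (Itv01 t0 t1).
  rewrite !inE/= !in_itv/= !andbT => /(_ x0 y0).
  by move=> h; rewrite -lerN2 opprD -!mulrN; exact: h.
rewrite convRE !mulrN -opprD lerN2; exact: fc.
Qed.

(** Concavity at the weight [(z - y) / (z - x)], with denominators cleared so that [x = z] is
    allowed and [nra] can use it. *)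
Lemma concave_nneg_chord f x y z : concave_nneg f -> 0 <= x -> x <= y <= z ->
  (z - y) * f x + (y - x) * f z <= (z - x) * f y.
Proof.
move=> fc x0 /andP[xy yz].
have [xz|xz] := eqVneq x z.
  have -> : y = x by apply/eqP; rewrite eq_le xy xz yz.
  by rewrite -xz !subrr !mul0r addr0.
have xltz : 0 < z - x by rewrite subr_gt0 lt_neqAle xz (le_trans xy).
pose t := (z - y) / (z - x).
have t0 : 0 <= t by rewrite divr_ge0 ?subr_ge0// (le_trans xy).
have t1 : t <= 1 by rewrite ler_pdivrMr// mul1r lerD2l lerN2.
have tzx : t * (z - x) = z - y by rewrite divfK// gt_eqF.
have /concave_nnegP/(_ t x z t0 t1 x0 (le_trans x0 (le_trans xy yz))) := fc.
have -> : t * x + (1 - t) * z = y.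
  by transitivity (z - t * (z - x)); [ring|rewrite tzx; ring].
rewrite -(ler_pM2l xltz); apply: le_trans; rewrite le_eqVlt; apply/orP; left.
apply/eqP; transitivity (t * (z - x) * f x + ((z - x) - t * (z - x)) * f z).
  by rewrite tzx; ring.
by ring.
Qed.

(** The right difference quotient [q] is nonincreasing in the step and bounded above by every chord
    slope to the left of [a], so the right derivative exists and is the supremum of [q]. For [y > a]
    the supremum dominates the quotient at step [y - a]; for [y < a] it is at most the chord slope
    from [y] to [a]. *)
Lemma concave_slope_supergradient f a y : concave_nneg f -> 0 < a -> 0 <= y ->
  f y <= f a + slope f a * (y - a).
Proof.
move=> fc a0 y0; pose q h := h^-1 * (f (h + a) - f a).
pose I := Interval (BRight (0 : R)) +oo%O.
have I_gt0 h : (h \in I) = (0 < h) by rewrite in_itv/= andbT.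
have q_left z h : 0 <= z -> z < a -> 0 < h -> q h <= (a - z)^-1 * (f a - f z).
  move=> z0 za h0; rewrite ler_pdivrMl// mulrCA ler_pdivlMl ?subr_gt0//.
  have : z <= a <= h + a by rewrite ltW//= lerDr ltW.
  by move=> /(concave_nneg_chord fc z0); nra.
have q_noninc : {in I &, nonincreasing_fun q}.
  move=> h k; rewrite !I_gt0 => h0 k0 hk; rewrite ler_pdivrMl// mulrCA ler_pdivlMl//.
  have : a <= h + a <= k + a by rewrite lerDr ltW//= lerD2r.
  by move=> /(concave_nneg_chord fc (ltW a0)); nra.
(* The bound is the slope of the chord from [0] to [a]; this is where [0 < a] matters. *)
have q_ub : has_ubound (q @` [set` I]).
  exists ((a - 0)^-1 * (f a - f 0)) => _ [h /= + <-].
  by rewrite I_gt0; exact: q_left.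
have -> : slope f a = sup (q @` [set` I]).
  exact/slope_right_limit/nonincreasing_at_right_cvgr.
have [ya|ay|->] := ltgtP y a; last by rewrite subrr mulr0 addr0.
- have : sup (q @` [set` I]) <= (a - y)^-1 * (f a - f y).
    apply: ge_sup; first by exists (q 1), 1 => //=; rewrite I_gt0.
    by move=> _ [h /= + <-]; rewrite I_gt0; exact: q_left.
  by rewrite ler_pdivlMl ?subr_gt0//; lra.
- have : (y - a)^-1 * (f y - f a) <= sup (q @` [set` I]).
    apply: sup_ubound => //; exists (y - a); first by rewrite /= I_gt0 subr_gt0.
    by rewrite /q subrK.
  by rewrite ler_pdivrMl ?subr_gt0//; lra.
Qed.

End SlopeOfConcave.

Lemma sqrt_gt1 (R : realType) (eps : R) : 0 < eps -> 1 < Num.sqrt (eps + 1).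
Proof. by move=> eps0; rewrite -[ltLHS]sqrtr1 ltr_sqrt ?ltrDr ?addr_gt0. Qed.

(** * One-variable bounds between a concave function and its tangent envelope *)

Section PwlApproximation.
Variables (R : realType) (eps : R) (f : R -> R) (l u : R).
Hypotheses (eps_gt0 : 0 < eps) (l_gt0 : 0 < l) (le_lu : l <= u).
Local Notation P := (num_pieces eps l u).
Local Notation g := (grid eps l).
Local Notation T := (tangent eps f l).
Local Notation psi := (pwl eps f l u).

Lemma grid_gt0 p : 0 < g p.
Proof. by rewrite mulr_gt0// exprn_gt0// addr_gt0. Qed.

Lemma grid_num_pieces_ge : u <= g P.
Proof.
have u_gt0 : 0 < u := lt_le_trans l_gt0 le_lu.
have eps1 : 0 < 1 + eps by rewrite addr_gt0.
have lneps : 0 < ln (1 + eps) by rewrite ln_gt0// ltrDl.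
rewrite -ler_pdivrMl// mulrC -ler_ln ?posrE ?divr_gt0 ?exprn_gt0//.
rewrite lnXn// -mulr_natr -ler_pdivrMl// mulrC.
apply: le_trans (ceil_ge _) _.
(* [num_pieces] is the absolute value of the ceiling, hence at least the ceiling. *)
by rewrite pmulrn ler_int abszE [_^-1 * ln _]mulrC [l^-1 * u]mulrC ler_norm.
Qed.

Lemma pwl_le_tangent x p : x != 0 -> (p <= P)%N -> psi x <= T p x.
Proof.
move=> x0 pP; rewrite /pwl (negPf x0) -ltnS in pP *.
exact: (bigmin_le _ (Ordinal pP)).
Qed.

Lemma pwl_at_grid p : (p <= P)%N -> psi (g p) <= f (g p).
Proof.
move=> pP; apply: le_trans (pwl_le_tangent (lt0r_neq0 (grid_gt0 p)) pP) _.
by rewrite /tangent /tangent_icpt mulrC subrK.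
Qed.

Hypothesis f_concave : concave_nneg f.

Lemma tangent_ge p x : 0 <= x -> f x <= T p x.
Proof.
move=> x0; have := concave_slope_supergradient f_concave (grid_gt0 p) x0.
by rewrite /tangent /tangent_icpt /tangent_slope; lra.
Qed.

Lemma pwl_ge x : 0 <= x -> f x <= psi x.
Proof.
rewrite /pwl => x0; case: eqVneq => [->//|_].
by apply: le_bigmin => [|p _]; exact: tangent_ge.
Qed.

Hypothesis f_ge0 : forall x, 0 <= x -> 0 <= f x.
Hypothesis f_nondecreasing : forall x y, 0 <= x -> x <= y -> f x <= f y.

(* With a < x < b = (1 + eps) a consecutive grid points, the tangent at a is at
   most f a * x / a since its intercept is nonnegative, the tangent at b is at
   most f b at x, and the chord between a and b bounds f x from below. *)
Lemma pwl_between_grid p x : (p < P)%N -> g p <= x <= g p.+1 ->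
  psi x <= (1 + Num.sqrt (eps + 1)) / 2 * f x.
Proof.
move=> pP /andP[ax xb].
have a0 := grid_gt0 p.
have x0 : 0 < x := lt_le_trans a0 ax.
set q := Num.sqrt (eps + 1).
have q2 : q ^+ 2 = eps + 1 by rewrite sqr_sqrtr// ltW// addr_gt0.
have q1 : 1 < q := sqrt_gt1 eps_gt0.
have bE : g p.+1 = q ^+ 2 * g p by rewrite q2 /grid exprS; ring.
have psia : g p * psi x <= f (g p) * x.
  have := pwl_le_tangent (lt0r_neq0 x0) (ltnW pP).
  (* At [0] the tangent equals its intercept, which is thus at least [f 0 >= 0]. *)
  have := tangent_ge p (lexx 0).
  have := f_ge0 (lexx 0).
  rewrite /tangent /tangent_icpt mulr0 addr0; set s := tangent_slope _ _ _ _.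
  move=> f0 icpt_ge mT; have icpt0 := le_trans f0 icpt_ge.
  have xa0 : 0 <= x - g p by rewrite subr_ge0.
  have := mulr_ge0 icpt0 xa0; have := ler_wpM2l (ltW a0) mT; lra.
have psib : psi x <= f (g p.+1).
  have b0 := grid_gt0 p.+1; have := pwl_le_tangent (lt0r_neq0 x0) pP.
  (* The tangent majorizes [f] one unit to the right of its contact point, where [f] has not
     decreased; hence its slope is nonnegative. *)
  have b1 : g p.+1 <= g p.+1 + 1 by rewrite lerDl.
  have := tangent_ge p.+1 (le_trans (ltW b0) b1).
  have := f_nondecreasing (ltW b0) b1.
  rewrite /tangent /tangent_icpt; set s := tangent_slope _ _ _ _ => fb1 Tb1.
  have : 0 <= s by lra.
  by move: xb; nra.
have := concave_nneg_chord f_concave (ltW a0) (introT andP (conj ax xb)).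
have m0 : 0 <= psi x := le_trans (f_ge0 (ltW x0)) (pwl_ge (ltW x0)).
move: psia psib xb; rewrite bE.
set a := g p in a0 ax *; set m := psi x in m0 *; set A := f a; set B := f (_ * a).
move=> Am Bm xb chord.
(* Inserting both bounds on [m] into the chord inequality leaves the coefficient
   [a * (q ^+ 2 * a - x) + x * (x - a)]. It exceeds [2 * a * x * (q - 1)] by the square of
   [x - q * a], which vanishes at the geometric mean. Dividing out leaves the factor [(q ^+ 2 - 1) /
   (2 * (q - 1)) = (1 + q) / 2]. *)
have mF : m * (2 * a * x * (q - 1)) <= x * ((q ^+ 2 * a - a) * f x).
  apply: (@le_trans _ _ (x * ((q ^+ 2 * a - x) * A + (x - a) * B))); last first.
    by rewrite ler_pM2l.
  apply: (@le_trans _ _ (m * (a * (q ^+ 2 * a - x) + x * (x - a)))).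
    by rewrite ler_wpM2l// -subr_ge0 (_ : _ - _ = (x - q * a) ^+ 2) ?sqr_ge0//; ring.
  have bx0 : 0 <= q ^+ 2 * a - x by rewrite subr_ge0.
  have xa0 : 0 <= x - a by rewrite subr_ge0.
  have := ler_wpM2l bx0 Am; have := ler_wpM2l (mulr_ge0 (ltW x0) xa0) Bm.
  by nra.
have c0 : 0 < 2 * a * x * (q - 1).
  by rewrite mulr_gt0 ?subr_gt0// (mulr_gt0 (mulr_gt0 _ a0)).
rewrite -(ler_pM2r c0); apply: le_trans mF _.
by rewrite le_eqVlt; apply/orP; left; apply/eqP; field.
Qed.

Lemma pwl_le x : x = 0 \/ l <= x <= u ->
  psi x <= (1 + Num.sqrt (eps + 1)) / 2 * f x.
Proof.
have c1 : 1 <= (1 + Num.sqrt (eps + 1)) / 2.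
  by rewrite ler_pdivlMr// mul1r lerD2l ltW// sqrt_gt1.
have f_le z : 0 <= z -> f z <= (1 + Num.sqrt (eps + 1)) / 2 * f z.
  by move=> z0; rewrite ler_peMl// f_ge0.
case=> [->|/andP[lx xu]]; first by rewrite {1}/pwl eqxx f_le.
have xP : exists p, x <= g p by exists P; exact: le_trans xu grid_num_pieces_ge.
(* The least grid index whose point reaches [x]: index [0] forces [x = l], where the tangent is
   exact; otherwise minimality puts [x] strictly above the preceding grid point. *)
have := ex_minnP xP; case=> -[|p] xp p_min.
  have -> : x = g 0%N.
    by apply/eqP; rewrite eq_le xp /grid expr0 mulr1 lx.
  exact: le_trans (pwl_at_grid _) (f_le _ (ltW (grid_gt0 0))).
have pP : (p.+1 <= P)%N by apply/p_min/(le_trans xu)/grid_num_pieces_ge.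
apply: (pwl_between_grid pP); rewrite xp andbT leNgt; apply/negP => /ltW.
by move=> /p_min; rewrite ltnn.
Qed.

End PwlApproximation.

(** * Existence of a minimizer of the piecewise-linear cost *)

Lemma continuous_bigmin (R : realType) (T : topologicalType) (I : Type)
    (r : seq I) (g : T -> R) (F : I -> T -> R) :
  continuous g -> (forall i, continuous (F i)) ->
  continuous (fun x => \big[Num.min/g x]_(i <- r) F i x).
Proof.
move=> cg cF; elim: r => [|i r IH].
  by under eq_fun do rewrite big_nil.
under eq_fun do rewrite big_cons.
by move=> x; apply: continuous_min; [exact: cF|exact: IH].
Qed.

(* Each summand may jump upwards as its argument leaves 0, so the sum is not
   continuous; on the part of X where the coordinates in S vanish, it is
   bounded above by a continuous function, with equality when S is the set of
   all vanishing coordinates. *)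
Lemma separable_jump_attains_min (R : realType) (n : nat) (X : set 'rV[R]_n)
    (c : 'I_n -> R) (g : 'I_n -> R -> R) :
  X !=set0 -> compact X -> (forall i, continuous (g i)) ->
  (forall i, c i <= g i 0) ->
  exists z, is_min_value
    (separable (fun i t => if t == 0 then c i else g i t)) X z.
Proof.
move=> X0 cX cg c_le; set psi := separable _.
pose F (S : {set 'I_n}) (x : 'rV[R]_n) :=
  \sum_(i < n) (if i \in S then c i else g i (x 0 i)).
pose Y (S : {set 'I_n}) : set 'rV[R]_n :=
  X `&` [set x | forall i, i \in S -> x 0 i = 0].
have psi_le S x : Y S x -> psi x <= F S x.
  move=> [_ xS]; apply: ler_sum => i _.
  case: ifPn => [/eqP x0|x0]; case: ifPn => // iS; first by rewrite x0.
  by rewrite (xS _ iS) eqxx in x0.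
have psi_zeros x : psi x = F [set i | x 0 i == 0]%SET x.
  by apply: eq_bigr => i _; rewrite inE.
have Fcont S : continuous (F S).
  apply: continuous_big => [|i _]; first exact: add_continuous.
  case: (i \in S); first by move=> x; exact: cst_continuous.
  by move=> x; apply: continuous_comp; [exact: coord_continuous|exact: cg].
have cY S : compact (Y S).
  have -> : Y S = X `&` \bigcap_(i in [set` S]) [set x : 'rV_n | x 0 i = 0].
    by apply/seteqP; split => x [Xx xS]; split => // i /xS.
  apply: compact_closedI => //; apply: closed_bigI => i _.
  apply: (@closed_comp _ _ (fun x : 'rV_n => x 0 i) [set 0]) => [x _|].
    exact: coord_continuous.
  exact: closed_eq.
(* Keeping nonemptiness inside the existential makes the choice function [m] total; its value on
   empty [Y S] is the dummy [0]. *)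
have minY S : exists x, Y S !=set0 -> Y S x /\ forall y, Y S y -> F S x <= F S y.
  have [YS|nYS] := pselect (Y S !=set0); last by exists 0.
  have [x + xmin] := EVT_min_rV YS (cY S) (continuous_subspaceT (Fcont S)).
  rewrite inE => Yx; exists x => _; split => // y Yy.
  by apply: xmin; rewrite inE.
have /choice[m m_min] := minY.
have Y0 : `[< Y finset.set0 !=set0 >].
  by apply/asboolP; have [x Xx] := X0; exists x; split => // i; rewrite inE.
(* Finitely many index sets remain, and the empty one is admissible because its [Y] is all of [X].
   With [Z] the zero set of [x], the conclusion is the chain [psi (m S) <= F S (m S) <= F Z (m Z) <=
   F Z x = psi x]. *)
have [S /asboolP YS S_min] :=
  @arg_minP _ _ _ finset.set0 (fun S => `[< Y S !=set0 >]) (fun S => F S (m S)) Y0.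
have [[Xm mS] _] := m_min S YS.
exists (psi (m S)); split; first by exists (m S).
move=> _ [x Xx <-]; rewrite (psi_zeros x).
set Z := finset _.
have Yx : Y Z x by split => // i; rewrite inE => /eqP.
have YZ : Y Z !=set0 by exists x.
apply: le_trans (psi_le S _ _) _ => //.
apply: le_trans (S_min Z _) _; first exact/asboolP.
by have [_] := m_min Z YZ; apply.
Qed.

(** Away from [0] each component is a finite minimum of affine functions; at [0] every tangent is at
    least [phi i 0], so the only possible jump is upwards. *)
Lemma separable_pwl_attains_min (R : realType) (n : nat) (eps : R)
    (X : set 'rV[R]_n) (phi : 'I_n -> R -> R) (l u : 'I_n -> R) :
  0 < eps -> concave_instance X phi l u ->
  exists z, is_min_value (separable_pwl eps phi l u) X z.
Proof.
move=> eps0 inst; pose T i := tangent eps (phi i) (l i).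
have T_cont i p : continuous (T i p).
  move=> x; apply: cvgD; first exact: cvg_cst.
  by apply: cvgM; [exact: cvg_cst|exact: cvg_id].
have [x [Xx _ _]] := bounded_optimum inst.
apply: (@separable_jump_attains_min _ _ X (fun i => phi i 0) (fun i x =>
  \big[Num.min/T i 0%N x]_(p < (num_pieces eps (l i) (u i)).+1) T i p x)).
- by exists x.
- exact: feasible_compact inst.
- by move=> i; apply: continuous_bigmin => [|p]; exact: T_cont.
- move=> i; have /andP[l0 _] := bounds_gt0 inst i.
  have T_ge p : phi i 0 <= T i p 0.
    by apply: tangent_ge => //; exact: cost_concave inst i.
  by apply: le_bigmin.
Qed.

(* The worst case, on the grid {1, q^2} with q = sqrt (1 + eps): the tangents
   at 1 and at q^2 both take the value q at q, where the chord of the graph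
   from (1, 1) to (q^2, q) is only 2 q / (q + 1).  Raising the chord by d > 0
   leaves room for the right derivative 1 at 1. *)
Section TightInstance.
Variables (R : realType) (eps q d : R).
Hypotheses (q_gt1 : 1 < q) (sqr_q : q ^+ 2 = 1 + eps) (d_gt0 : 0 < d).

Definition tight_cost (x : R) : R :=
  Num.min (Num.min x q) (1 + d + (q + 1)^-1 * (x - 1)).
Local Notation f := tight_cost.

Let q_gt0 : 0 < q. Proof. exact: lt_trans q_gt1. Qed.
Let eps_gt0 : 0 < eps.
Proof. by have := q_gt1; have := sqr_q; nra. Qed.
Let s_gt0 : 0 < (q + 1)^-1. Proof. by rewrite invr_gt0 addr_gt0. Qed.
Let s_lt1 : (q + 1)^-1 < 1. Proof. by rewrite invf_lt1 ?addr_gt0// ltrDr. Qed.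

Lemma tight_cost_ge0 (x : R) : 0 <= x -> 0 <= f x.
Proof.
move=> x0; rewrite !le_min x0 (ltW q_gt0)/=.
move: (mulr_ge0 (ltW s_gt0) x0) s_lt1; set s := _^-1 => sx s1.
by have := d_gt0; lra.
Qed.

Lemma tight_cost_nondecreasing (x y : R) : x <= y -> f x <= f y.
Proof.
move=> xy; rewrite !le_min !ge_min xy lexx !orbT/=; apply/orP; right.
by rewrite lerD2l ler_pM2l// lerD2r.
Qed.

Lemma tight_cost_concave : concave_nneg f.
Proof.
apply/concave_nnegP => t x y t0 t1 _ _.
have t1' : 0 <= 1 - t by rewrite subr_ge0.
have fx : [/\ f x <= x, f x <= q & f x <= 1 + d + (q + 1)^-1 * (x - 1)].
  by rewrite !ge_min !lexx !orbT.
have fy : [/\ f y <= y, f y <= q & f y <= 1 + d + (q + 1)^-1 * (y - 1)].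
  by rewrite !ge_min !lexx !orbT.
case: fx => [fx1 fx2 fx3]; case: fy => [fy1 fy2 fy3].
rewrite [leRHS]/tight_cost !le_min -andbA; apply/and3P; split.
- by apply: lerD; rewrite ler_wpM2l.
- by have := ler_wpM2l t0 fx2; have := ler_wpM2l t1' fy2; lra.
- by have := ler_wpM2l t0 fx3; have := ler_wpM2l t1' fy3; lra.
Qed.

(** An interval of positive length to the right of [1], thanks to [d > 0], gives right derivative
    [1] there. *)
Lemma tight_cost_at1 (x : R) : 1 <= x <= Num.min (1 + d) q -> f x = x.
Proof.
rewrite le_min => /and3P[x1 xd xq]; rewrite /tight_cost (min_idPl xq).
apply/min_idPl; have : 0 <= (q + 1)^-1 * (x - 1) by rewrite mulr_ge0 ?subr_ge0// ltW.
by lra.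
Qed.

(** The raised chord takes the value [q + d] at [q ^+ 2], so the cap [q] is active from there on and
    the tangent is horizontal. *)
Lemma tight_cost_ge_sqr (x : R) : 1 + eps <= x -> f x = q.
Proof.
rewrite -sqr_q => xq.
have qx : q <= x by apply: le_trans xq; rewrite expr2 ler_peMl// ltW.
rewrite /tight_cost (min_idPr qx); apply/min_idPl.
have : (q + 1)^-1 * (q ^+ 2 - 1) <= (q + 1)^-1 * (x - 1) by rewrite ler_pM2l// lerD2r.
rewrite (_ : _ * (q ^+ 2 - 1) = q - 1); first by have := d_gt0; lra.
by field; rewrite gt_eqF// addr_gt0.
Qed.

Lemma tight_cost_at_q : f q <= d + 2 * q / (q + 1).
Proof.
rewrite !ge_min; apply/orP; right; rewrite le_eqVlt; apply/orP; left; apply/eqP.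
by field; rewrite gt_eqF// addr_gt0.
Qed.

Lemma tight_pwl_at_q : q <= pwl eps f 1 (1 + eps) q.
Proof.
have eps1 : 1 < 1 + eps by rewrite ltrDl.
have one_itv : 1 <= (1 : R) <= Num.min (1 + d) q.
  by rewrite le_min lexx lerDl !ltW.
have T0 : tangent eps f 1 0 q = q.
  rewrite /tangent /tangent_icpt /tangent_slope /grid expr0 mulr1.
  rewrite (@slope_right_affine _ _ _ (Num.min (1 + d) q) 1).
  - by rewrite tight_cost_at1//; lra.
  - by rewrite lt_min q_gt1 ltrDl d_gt0.
  - move=> x xI; rewrite !tight_cost_at1//; lra.
have T1 : tangent eps f 1 1 q = q.
  rewrite /tangent /tangent_icpt /tangent_slope /grid expr1 mul1r.
  rewrite (@slope_right_affine _ _ _ (1 + eps + 1) 0).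
  - by rewrite tight_cost_ge_sqr//; lra.
  - by rewrite ltrDl.
  - by move=> x /andP[x1 _]; rewrite mul0r addr0 !tight_cost_ge_sqr.
have P1 : num_pieces eps 1 (1 + eps) = 1%N.
  rewrite /num_pieces divr1 divff ?ceil1//.
  by rewrite gt_eqF// ln_gt0.
rewrite /pwl gt_eqF// P1; apply: le_bigmin; first by rewrite T0.
by case=> -[|[|//]] p2 _ /=; rewrite ?T0 ?T1.
Qed.

(** A single feasible point turns both minima into evaluations at [q]; the bounds [1] and [1 + eps]
    produce exactly the two grid points [1] and [q ^+ 2]. *)
Lemma tight_instance : concave_instance [set (const_mx q : 'rV[R]_1)]
  (fun=> f) (fun=> 1) (fun=> 1 + eps).
Proof.
split.
- by move=> x -> i; rewrite mxE ltW.
- exact: compact_set1.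
- by move=> _ x; exact: tight_cost_ge0.
- by move=> _ x y _; exact: tight_cost_nondecreasing.
- by move=> _; exact: tight_cost_concave.
- by move=> _; rewrite ltr01 lerDl ltW.
- exists (const_mx q); split=> // [x ->//|i]; right.
  by rewrite mxE ltW//= -sqr_q expr2 ler_peMl// ltW.
Qed.

End TightInstance.

Lemma is_min_value_set1 (R : realType) (T : Type) (F : T -> R) (x : T) :
  is_min_value F [set x] (F x).
Proof. by split; [exists x|move=> _ [y -> <-]]. Qed.

Theorem theorem1 (R : realType) (eps : R) (eps_gt0 : 0 < eps) :
  (forall (n : nat) (X : set 'rV[R]_n) (phi : 'I_n -> R -> R)
          (l u : 'I_n -> R),
     concave_instance X phi l u ->
     exists Zconc Zpwl : R,
       [/\ is_min_value (separable phi) X Zconc,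
           is_min_value (separable_pwl eps phi l u) X Zpwl,
           Zconc <= Zpwl &
           Zpwl <= (1 + Num.sqrt (eps + 1)) / 2 * Zconc])
  /\
  (forall c : R, c < (1 + Num.sqrt (eps + 1)) / 2 ->
     exists (n : nat) (X : set 'rV[R]_n) (phi : 'I_n -> R -> R)
            (l u : 'I_n -> R),
       concave_instance X phi l u /\
       exists Zconc Zpwl : R,
         [/\ is_min_value (separable phi) X Zconc,
             is_min_value (separable_pwl eps phi l u) X Zpwl &
             c * Zconc < Zpwl]).
Proof.
split=> [n X phi l u inst|c c_lt].
  have [xopt [Xxopt xopt_min xopt_bd]] := bounded_optimum inst.
  have [Zpwl Zpwl_min] := separable_pwl_attains_min eps_gt0 inst.
  have conc i : concave_nneg (phi i) := cost_concave inst i.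
  exists (separable phi xopt), Zpwl; split=> //.
  - by split; [exists xopt|move=> _ [x Xx <-]; exact: xopt_min].
  - have [[x Xx <-] _] := Zpwl_min.
    apply: le_trans (xopt_min x Xx) _; apply: ler_sum => i _.
    have /andP[l0 _] := bounds_gt0 inst i.
    by apply: pwl_ge => //; exact: feasible_ge0 inst _ Xx _.
  - have [_ Zpwl_lb] := Zpwl_min.
    (* Only the coordinates of [xopt] are known to lie in the range covered by the grid, so [Zpwl]
       is compared with the approximate cost there. *)
    apply: (le_trans (Zpwl_lb (separable_pwl eps phi l u xopt) _)).
      by exists xopt.
    rewrite mulr_sumr; apply: ler_sum => i _.
    have /andP[l0 lu] := bounds_gt0 inst i.
    apply: pwl_le (xopt_bd i) => //.
    + exact: cost_ge0 inst i.
    + exact: cost_nondecreasing inst i.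
set q := Num.sqrt (eps + 1) in c_lt *.
have q1 : 1 < q := sqrt_gt1 eps_gt0.
have q2 : q ^+ 2 = 1 + eps by rewrite sqr_sqrtr addrC// ltW// addr_gt0.
clearbody q.
(* [m] is the chord value at [q] before raising; since [q / m = (1 + q) / 2], the assumption on [c]
   says exactly that [c * m < q]. *)
pose m := 2 * q / (q + 1).
have gap : 0 < q - c * m.
  rewrite subr_gt0 /m mulrA ltr_pdivrMr; last lra.
  by nra.
(* The true cost is at most [d + m]. For [c > 0] this choice makes [c * d] smaller than the gap
   [q - c * m], while the denominator is positive for every [c]. *)
pose d := (q - c * m) / (1 + `|c|).
have c1 : 0 < 1 + `|c| by rewrite ltr_pwDl.
have d0 : 0 < d by rewrite divr_gt0.
have dE : d * (1 + `|c|) = q - c * m by rewrite divfK// gt_eqF.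
exists 1%N, [set const_mx q], (fun=> tight_cost q d), (fun=> 1), (fun=> 1 + eps).
split; first exact: tight_instance.
do 2 eexists; split; [exact: is_min_value_set1|exact: is_min_value_set1|].
rewrite /separable_pwl /separable !big_ord1 !mxE.
apply: lt_le_trans (tight_pwl_at_q q1 q2 d0).
have f0 : 0 <= tight_cost q d q.
  by apply: tight_cost_ge0 => //; apply: ltW; apply: lt_trans q1.
have := tight_cost_at_q d q1; rewrite -/m.
move: f0; set y := tight_cost _ _ _ => y0 ym.
have [c0|c0] := leP c 0.
  by apply: le_lt_trans (lt_trans ltr01 q1); rewrite mulr_le0_ge0.
move: dE; rewrite gtr0_norm// => dE.
have := ler_wpM2l (ltW c0) ym.
by lra.
Qed.
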